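(* Let $G$ be a finite simple connected graph. Then $G$ is complete intersection if and only if for every subset $H\subseteq V(G)$ the induced subgraph $G_H$ is complete intersection.
   Context: For a finite simple graph $G$ with vertices $v_1,\dots,v_n$ and edges $e_1,\dots,e_m$, and a field $K$, the toric ideal $I_G\subseteq K[e_1,\dots,e_m]$ is the kernel of the $K$-algebra homomorphism $K[e_1,\dots,e_m]\to K[v_1,\dots,v_n]$ sending $e_i=\{v_j,v_k\}$ to $v_jv_k$; it is generated by binomials. The graph $G$ is called complete intersection if $I_G$ is generated by $\operatorname{ht}(I_G)$ elements (for connected $G$, $\operatorname{ht}(I_G)=m-n+1$ if $G$ is bipartite and $m-n$ otherwise). For $H\subseteq V(G)$, the induced subgraph $G_H$ has vertex set $H$ and all edges of $G$ with both endpoints in $H$. *)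

(* Defs.v *)
From HB Require Import structures.
From mathcomp Require Import all_boot all_order all_algebra.
Set Implicit Arguments. Unset Strict Implicit. Unset Printing Implicit Defensive.
Import Order.TTheory GRing.Theory.
Local Open Scope ring_scope.

(* mpoly R n = R[x_0, ..., x_{n-1}], with x_{n-1} the outermost variable. *)
Fixpoint mpoly (R : comNzRingType) (n : nat) : comNzRingType :=
  match n with
  | 0 => R
  | n'.+1 => ({poly mpoly R n'} : comNzRingType)
  end.

Fixpoint mconst (R : comNzRingType) (n : nat) : R -> mpoly R n :=
  match n return R -> mpoly R n with
  | 0 => fun c => c
  | n'.+1 => fun c => (mconst n' c)%:P
  end.

(* the variable x_i of mpoly R n (meaningful for i < n) *)
Fixpoint mX (R : comNzRingType) (n : nat) (i : nat) : mpoly R n :=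
  match n return mpoly R n with
  | 0 => 0
  | n'.+1 => if i == n' then 'X else (mX R n' i)%:P
  end.

Fixpoint meval (R : comNzRingType) (n : nat) (S : comNzRingType)
    (c : R -> S) (v : nat -> S) : mpoly R n -> S :=
  match n return mpoly R n -> S with
  | 0 => c
  | n'.+1 => fun p => (map_poly (@meval R n' S c v) p).[v n']
  end.

Definition is_ideal (R : comNzRingType) (I : R -> Prop) : Prop :=
  I 0 /\ (forall a b, I a -> I b -> I (a + b)) /\ (forall r a, I a -> I (r * a)).

Definition is_prime_ideal (R : comNzRingType) (P : R -> Prop) : Prop :=
  is_ideal P /\ ~ P 1 /\ (forall a b, P (a * b) -> P a \/ P b).

Definition generated_by (R : comNzRingType) (gs : seq R) (I : R -> Prop) : Prop :=
  forall p, I p <-> exists cs : seq R,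
      size cs = size gs /\ p = \sum_(i < size gs) cs`_i * gs`_i.

Definition prime_chain_to (R : comNzRingType) (P : R -> Prop) (k : nat) : Prop :=
  exists Q : nat -> R -> Prop,
    (forall i, (i <= k)%N -> is_prime_ideal (Q i)) /\
    (forall i, (i < k)%N ->
        (forall x, Q i x -> Q i.+1 x) /\ exists x, Q i.+1 x /\ ~ Q i x) /\
    (forall x, Q k x <-> P x).

(* ht(I) = h : the minimum over primes P containing I of ht(P) is h,
   where ht(P) is the supremum of lengths of prime chains ending at P. *)
Definition ideal_height (R : comNzRingType) (I : R -> Prop) (h : nat) : Prop :=
  (forall P, is_prime_ideal P -> (forall x, I x -> P x) -> prime_chain_to P h) /\
  (exists P, is_prime_ideal P /\ (forall x, I x -> P x) /\ ~ prime_chain_to P h.+1).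

Definition simple_graph (V : finType) (adj : rel V) : Prop :=
  symmetric adj /\ irreflexive adj.

Definition connected_graph (V : finType) (adj : rel V) : Prop :=
  forall x y, connect adj x y.

Definition edges (V : finType) (adj : rel V) : {set {set V}} :=
  [set [set x; y] | x in V, y in V & adj x y].

Definition nedges (V : finType) (adj : rel V) : nat := #|edges adj|.

Definition edge_ring (K : fieldType) (V : finType) (adj : rel V) : comNzRingType :=
  mpoly K (nedges adj).

Definition vertex_ring (K : fieldType) (V : finType) : comNzRingType :=
  mpoly K #|V|.

Arguments edge_ring K {V} adj.
Arguments vertex_ring K V.

Definition edge_monomial (K : fieldType) (V : finType) (adj : rel V) (i : nat)
  : vertex_ring K V :=
  \prod_(v in nth set0 (enum (edges adj)) i) mX K #|V| (enum_rank v).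

Arguments edge_monomial K {V} adj i.

Definition toric_map (K : fieldType) (V : finType) (adj : rel V) :
  edge_ring K adj -> vertex_ring K V :=
  @meval K (nedges adj) (vertex_ring K V) (@mconst K #|V|) (edge_monomial K adj).

Arguments toric_map K {V} adj.

Definition toric_ideal (K : fieldType) (V : finType) (adj : rel V) :
  edge_ring K adj -> Prop := fun p => toric_map K adj p = 0.

Arguments toric_ideal K {V} adj.

Definition complete_intersection (K : fieldType) (V : finType) (adj : rel V) : Prop :=
  exists h, ideal_height (toric_ideal K adj) h /\
    exists gs : seq (edge_ring K adj), size gs = h /\ generated_by gs (toric_ideal K adj).

Arguments complete_intersection K {V} adj.

Definition induced_adj (V : finType) (adj : rel V) (H : {set V}) :
  rel {x : V | x \in H} := fun x y => adj (val x) (val y).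
Arguments induced_adj {V} adj H.

(* Main.v *)
From HB Require Import structures.
From mathcomp Require Import all_boot all_order all_algebra.
From mathcomp Require Import ssrcomplements mpoly.
Require Import Defs.

(* For a toric map x_i |-> X^(a_i) in m variables, the kernel I has height m - d, with d
   the rank of the matrix (a_i) over the rationals. A chain of primes of length k ending
   at I yields d + k algebraically independent polynomials, so d + k <= m; conversely,
   tagging the variables outside a row basis by fresh independent variables and removing
   the tags one by one gives a chain of length m - d.

   If I is generated by m - d elements, then graded Nakayama extracts from the binomials
   of I at most m - d binomial generators. Their exponent differences span the
   (m - d)-dimensional kernel lattice, hence are linearly independent. An induced subgraph
   is a face: a fiber of the exponent map meeting the monomials on the face lies entirely
   on it. So the retraction killing the other edges maps each generator to itself or to 0,
   the surviving ones generate the toric ideal of the subgraph, and being independent they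
   are at most as many as its height. *)

Set Implicit Arguments. Unset Strict Implicit. Unset Printing Implicit Defensive.
Import Order.TTheory GRing.Theory Num.Theory.
Local Open Scope ring_scope.

(** * Prime chains and isomorphisms *)

Section PrimeChains.

Variable R : comNzRingType.
Implicit Types (P I : R -> Prop) (h k l : nat).

Definition ci_ideal I : Prop :=
  exists h, ideal_height I h /\ exists gs : seq R, size gs = h /\ generated_by gs I.

Lemma prime_chain_leq P k l : (l <= k)%N -> prime_chain_to P k -> prime_chain_to P l.
Proof.
move=> lk [Q [Qpr [Qinc Qk]]]; exists (fun i => Q (i + (k - l))%N); split=> [i il|].
  by apply: Qpr; rewrite -[leqRHS](subnKC lk) leq_add2r.
split=> [i il|x]; last by rewrite subnKC.
by rewrite addSn; apply: Qinc; rewrite -[ltnRHS](subnKC lk) ltn_add2r.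
Qed.

(** Only the top of the chain is replaced, by [P']; the last inclusion stays strict because its
    witness already lies in [P]. *)
Lemma prime_chain_sub P P' k : is_prime_ideal P' -> (forall x, P x -> P' x) ->
  prime_chain_to P k -> prime_chain_to P' k.
Proof.
move=> P'pr sPP' [Q [Qpr [Qinc Qk]]].
exists (fun i => if i == k then P' else Q i); split=> [i|].
  by case: eqP => // _; apply: Qpr.
split=> [i ik|x]; last by rewrite eqxx.
rewrite (ltn_eqF ik); have [sub [y [Qy nQy]]] := Qinc i ik.
case: (eqVneq i.+1 k) => [e|_]; last by split=> //; exists y.
move: sub Qy; rewrite e => sub Qy.
by split=> [x /sub /Qk /sPP'|] //; exists y; split=> //; apply/sPP'/Qk.
Qed.

Lemma ideal_height_prime I h : is_prime_ideal I ->
  prime_chain_to I h -> ~ prime_chain_to I h.+1 -> ideal_height I h.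
Proof.
move=> Ipr Ih Ih1; split; last by exists I.
by move=> P Ppr sIP; apply: prime_chain_sub Ih.
Qed.

(** [I] is one of the primes over itself, which gives [h <= k]; a longer chain at [I] could be
    pushed up to the prime [P] that attains the minimum, which gives [k <= h]. *)
Lemma ideal_height_prime_uniq I h k : is_prime_ideal I -> ideal_height I h ->
  prime_chain_to I k -> ~ prime_chain_to I k.+1 -> h = k.
Proof.
move=> Ipr [Ih [P [Ppr [sIP nP]]]] Ik nIk.
apply/eqP; rewrite eqn_leq; apply/andP; split; rewrite leqNgt; apply/negP => lt.
  by apply: nIk; apply: prime_chain_leq lt _; apply: Ih.
by apply: nP; apply: prime_chain_sub Ppr sIP _; apply: prime_chain_leq Ik.
Qed.

Lemma generated_by_in gs I i : generated_by gs I -> (i < size gs)%N -> I gs`_i.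
Proof.
move=> gI lti; apply/gI; exists (mkseq (fun j => (j == i)%:R) (size gs)).
rewrite size_mkseq; split=> //.
rewrite (bigD1 (Ordinal lti)) //= nth_mkseq // eqxx mul1r big1 ?addr0 // => j.
by rewrite -val_eqE /= => /negbTE nji; rewrite nth_mkseq // nji mul0r.
Qed.

Lemma ideal_sum I (J : Type) (r : seq J) (P : pred J) (F : J -> R) : is_ideal I ->
  (forall i, P i -> I (F i)) -> I (\sum_(i <- r | P i) F i).
Proof. by move=> [I0 [ID _]] IF; apply: (big_ind I). Qed.

End PrimeChains.

Lemma prime_ideal_preim (R S : comNzRingType) (f : {rmorphism R -> S}) (P : S -> Prop) :
  is_prime_ideal P -> is_prime_ideal (fun x => P (f x)).
Proof.
move=> [[P0 [PD PM]] [P1 Ppr]]; split; last split.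
- by split; rewrite ?rmorph0 //; split=> [a b|r a]; rewrite (rmorphD, rmorphM) /=; auto.
- by rewrite rmorph1.
- by move=> a b; rewrite rmorphM; apply: Ppr.
Qed.

Lemma prime_ideal_ker (R : comNzRingType) (S : idomainType) (f : {rmorphism R -> S}) :
  is_prime_ideal (fun x => f x = 0).
Proof.
have zero_prime : @is_prime_ideal S (fun x => x = 0).
  split; last split.
  - by split=> //; split=> [a b -> ->|r a ->]; rewrite ?addr0 ?mulr0.
  - by apply/eqP/oner_neq0.
  - by move=> a b /eqP; rewrite mulf_eq0 => /orP[]/eqP; [left|right].
exact: (prime_ideal_preim f zero_prime).
Qed.

Section Isomorphism.

Variables (R S : comNzRingType) (f : {rmorphism R -> S}) (g : {rmorphism S -> R}).
Hypotheses (fK : cancel f g) (gK : cancel g f).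

Lemma prime_chain_iso (P : S -> Prop) k :
  prime_chain_to P k -> prime_chain_to (fun x => P (f x)) k.
Proof.
move=> [Q [Qpr [Qinc Qk]]]; exists (fun i x => Q i (f x)); split=> [i ik|].
  by apply: prime_ideal_preim; apply: Qpr.
split=> [i ik|x]; last exact: Qk.
have [sub [y [Qy nQy]]] := Qinc i ik; split=> [x|]; first exact: sub.
by exists (g y); rewrite gK.
Qed.

Lemma generated_by_iso (gs : seq S) (I : S -> Prop) :
  generated_by gs I -> generated_by (map g gs) (fun x => I (f x)).
Proof.
move=> gI x; split.
  move=> /gI[cs [scs e]]; exists (map g cs); rewrite !size_map; split=> //.
  rewrite -[LHS]fK e rmorph_sum; apply: eq_bigr => i _.
  by rewrite rmorphM !(nth_map 0) ?scs.
move=> [cs [+ ->]]; rewrite size_map => scs; apply/gI; exists (map f cs).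
rewrite !size_map; split=> //; rewrite rmorph_sum; apply: eq_bigr => i _.
by rewrite rmorphM !(nth_map 0) ?scs // gK.
Qed.

End Isomorphism.

Lemma ci_ideal_iso (R S : comNzRingType) (f : {rmorphism R -> S})
    (g : {rmorphism S -> R}) (I : S -> Prop) (J : R -> Prop) :
  cancel f g -> cancel g f -> (forall x, J x <-> I (f x)) ->
  ci_ideal I -> ci_ideal J.
Proof.
move=> fK gK JI [h [[Ih [P [Ppr [sIP nP]]]] [gs [sgs gsI]]]].
exists h; split; [split|].
- move=> P' P'pr sJP'.
  have: prime_chain_to (fun y => P' (g y)) h.
    apply: Ih => [|y Iy]; first exact: prime_ideal_preim.
    by apply: sJP'; apply/JI; rewrite gK.
  move/(prime_chain_iso gK) => [Q [Qpr [Qinc Qk]]].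
  by exists Q; do 2!split=> //; move=> x; rewrite Qk fK.
- exists (fun x => P (f x)); split; first exact: prime_ideal_preim.
  split=> [x /JI /sIP //|]; move/(prime_chain_iso fK) => [Q [Qpr [Qinc Qk]]].
  by apply: nP; exists Q; do 2!split=> //; move=> x; rewrite Qk gK.
- exists (map g gs); rewrite size_map; split=> // x.
  by rewrite JI; apply: generated_by_iso.
Qed.

(** * Iterated univariate polynomials and multivariate polynomials *)

Section IteratedPolynomials.

Variable R : comNzRingType.

Lemma mconst_rmorphism n : exists f : {rmorphism R -> Defs.mpoly R n}, f =1 mconst n.
Proof.
elim: n => [|n [f fE]]; first by exists (idfun : {rmorphism R -> R}).
exists ((@polyC (Defs.mpoly R n) \o f) : {rmorphism R -> {poly Defs.mpoly R n}}).
by move=> x /=; rewrite fE.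
Qed.

Lemma meval_rmorphism (S : comNzRingType) (c : {rmorphism R -> S}) (v : nat -> S) n :
  exists f : {rmorphism Defs.mpoly R n -> S}, f =1 Defs.meval c v.
Proof.
elim: n => [|n [f fE]]; first by exists c.
exists ((horner_eval (v n) \o map_poly f) : {rmorphism {poly Defs.mpoly R n} -> S}).
move=> x /=; rewrite /horner_eval; congr (_.[_]).
by apply: eq_map_poly.
Qed.

Lemma mevalC (S : comNzRingType) (c : {rmorphism R -> S}) (v : nat -> S) n x :
  Defs.meval c v (mconst n x) = c x.
Proof.
elim: n => //= n IH; have [f fE] := meval_rmorphism c v n.
by rewrite -(eq_map_poly fE) map_polyC hornerC /= fE.
Qed.

Lemma mevalX (S : comNzRingType) (c : {rmorphism R -> S}) (v : nat -> S) n i :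
  (i < n)%N -> Defs.meval c v (Defs.mX R n i) = v i.
Proof.
elim: n => //= n IH; have [f fE] := meval_rmorphism c v n.
rewrite ltnS -(eq_map_poly fE) leq_eqVlt.
by case: eqP => [-> _|_ /= lin]; rewrite ?map_polyX ?hornerX // map_polyC hornerC /= fE IH.
Qed.

Lemma eq_meval (S : comNzRingType) (c c' : R -> S) (v w : nat -> S) n :
  c =1 c' -> (forall i, (i < n)%N -> v i = w i) ->
  Defs.meval c v =1 Defs.meval (n := n) c' w.
Proof.
move=> cc'; elim: n => //= n IH vw x; rewrite vw //; congr (_.[_]).
by apply: eq_map_poly => y; apply: IH => i ltin; apply: vw; rewrite ltnW.
Qed.

Lemma iter_poly_ext (S : comNzRingType) n (f g : {rmorphism Defs.mpoly R n -> S}) :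
  (forall x, f (mconst n x) = g (mconst n x)) ->
  (forall i, (i < n)%N -> f (Defs.mX R n i) = g (Defs.mX R n i)) -> f =1 g.
Proof.
elim: n f g => [|n IH] f g fgC fgX //.
have fgP : f \o polyC =1 g \o polyC.
  apply: IH => [x|i ltin] /=; first exact: fgC.
  by have := fgX i (ltnW ltin); rewrite /= (ltn_eqF ltin).
have fgXn : f 'X = g 'X by have := fgX n (leqnn _); rewrite /= eqxx.
elim/poly_ind => [|p a IHp]; first by rewrite !rmorph0.
by have /= := fgP a; rewrite !rmorphD !rmorphM /= IHp fgXn => ->.
Qed.

End IteratedPolynomials.

Section MpolyIso.

Variables (K : fieldType) (n : nat).

(** [meval] expects values indexed by all naturals; indices from [n] on receive the dummy value
    0. *)
Definition var_or0 (i : nat) : {mpoly K[n]} := if insub i is Some j then 'X_j else 0.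

Lemma mpoly_ext (S : comNzRingType) (f g : {rmorphism {mpoly K[n]} -> S}) :
  (forall x, f x%:MP = g x%:MP) -> (forall i, f 'X_i = g 'X_i) -> f =1 g.
Proof.
move=> fgC fgX p; rewrite (mpolyE p) !rmorph_sum; apply: eq_bigr => m _.
rewrite -mul_mpolyC !rmorphM fgC mpolyXE_id; congr (_ * _).
by rewrite !rmorph_prod; apply: eq_bigr => i _; rewrite !rmorphXn /= fgX.
Qed.

(** Moves all questions to [{mpoly K[n]}], where monomials, supports and degrees are at hand. *)
Lemma iter_poly_mpoly_iso :
  exists (f : {rmorphism Defs.mpoly K n -> {mpoly K[n]}})
         (g : {rmorphism {mpoly K[n]} -> Defs.mpoly K n}),
    [/\ f =1 Defs.meval (@mpolyC n K) var_or0, cancel f g, cancel g f,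
        forall x, g x%:MP = mconst n x & forall i : 'I_n, g 'X_i = Defs.mX K n i].
Proof.
have [f fE] := meval_rmorphism (@mpolyC n K) var_or0 n.
have [c cE] := mconst_rmorphism K n.
pose g : {rmorphism {mpoly K[n]} -> Defs.mpoly K n} :=
  mmap c (fun i : 'I_n => Defs.mX K n i).
have gC x : g x%:MP = mconst n x by rewrite [LHS]mmapC -cE.
have gX (i : 'I_n) : g 'X_i = Defs.mX K n i by rewrite [LHS]mmapX mmap1U.
have fC x : f (mconst n x) = x%:MP by rewrite fE mevalC.
have fX (i : 'I_n) : f (Defs.mX K n i) = 'X_i.
  by rewrite fE mevalX // /var_or0 valK.
exists f, g; split=> //.
  apply: (@iter_poly_ext _ _ _ (g \o f) idfun) => [x|i lti] /=; first by rewrite fC gC.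
  by rewrite (fX (Ordinal lti)) gX.
by apply: (@mpoly_ext _ (f \o g) idfun) => [x|i] /=; rewrite ?gC ?gX.
Qed.

End MpolyIso.

(** * Algebraically independent families along prime chains *)

(* An element of [Q] outside [P] is transcendental over any family that is
   algebraically independent modulo [Q]. *)
Lemma alg_indep_extend (R S : comNzRingType) (c : {rmorphism R -> S}) (P Q : S -> Prop)
    (v : nat -> S) (f : S) r :
  is_prime_ideal P -> is_ideal Q -> (forall x, P x -> Q x) -> Q f -> ~ P f ->
  (forall p : Defs.mpoly R r, Q (Defs.meval c v p) -> p = 0) ->
  exists w, forall p : Defs.mpoly R r.+1, P (Defs.meval c w p) -> p = 0.
Proof.
move=> [_ [_ Ppr]] [Q0 [QD QM]] sPQ Qf nPf vind.
(* [f] takes the outermost variable, so [p] is univariate in it with coefficients in the old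
   variables. *)
exists (fun i => if i == r then f else v i) => p; set w := fun i => _.
have [g gE] := meval_rmorphism c v r.
rewrite /= {2}/w eqxx.
have -> : map_poly (Defs.meval c w) p = map_poly g p.
  apply: eq_map_poly => x; rewrite gE; apply: eq_meval => // i ltir.
  by rewrite /w (ltn_eqF ltir).
(* For [p * 'X + a], the value of [a] lies in [Q] since [f] does, so [a = 0]; then primality of [P]
   cancels the factor [f], which is not in [P]. *)
elim/poly_ind: p => [//|p a IHp].
rewrite rmorphD rmorphM /= map_polyX map_polyC hornerMXaddC /= => Ppa.
have a0 : a = 0.
  apply: vind; rewrite -gE -[g a](addKr ((map_poly g p).[f] * f)).
  by apply: QD; [rewrite -mulNr; apply: QM | apply: sPQ].
move: Ppa; rewrite a0 rmorph0 addr0 => /Ppr[/IHp ->|//].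
by rewrite mul0r add0r.
Qed.

Section Dependence.

Variables (K : fieldType) (m r : nat).

Definition deg_le (d : nat) (p : {mpoly K[m]}) := forall b, b \in msupp p -> (mdeg b <= d)%N.

Lemma deg_leM d e p q : deg_le d p -> deg_le e q -> deg_le (d + e) (p * q).
Proof.
move=> pd qe b /msuppM_le /allpairsP[[b1 b2] /= [b1p b2q ->]].
by rewrite mdegD leq_add ?pd ?qe.
Qed.

Lemma deg_le1 : deg_le 0 1.
Proof. by move=> b; rewrite -mpolyC1 msupp1 inE => /eqP->; rewrite mdeg0. Qed.

Lemma deg_leX d p k : deg_le d p -> deg_le (d * k) (p ^+ k).
Proof.
move=> pd; elim: k => [|k IH]; first by rewrite muln0; apply: deg_le1.
by rewrite mulnS exprS; apply: deg_leM.
Qed.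

Lemma deg_le_mmap1 d N (y : 'I_r -> {mpoly K[m]}) (b : 'X_{1..r}) :
  (forall i, deg_le d (y i)) -> (forall i, b i <= N)%N -> deg_le (r * (d * N)) (mmap1 y b).
Proof.
move=> yd bN; have -> : (r * (d * N) = \sum_(i < r) d * N)%N by rewrite sum_nat_const card_ord.
apply: (big_ind2 deg_le) => [||i _]; first exact: deg_le1.
  by move=> ? ? ? ?; apply: deg_leM.
by move=> c /(deg_leX (yd i)) /leq_trans-> //; rewrite leq_mul2l bN orbT.
Qed.

(* Counting monomials: the [N ^ r] products of powers of [r] polynomials live in a
   space of dimension [O(N ^ m)]. *)
Lemma mpoly_dependent (y : 'I_r -> {mpoly K[m]}) : (m < r)%N ->
  exists2 p : {mpoly K[r]}, p != 0 & mmap (@mpolyC m K) y p = 0.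
Proof.
move=> ltmr; pose d := \max_i msize (y i).
have yd i : deg_le d (y i).
  by move=> b /msize_mdeg_lt /ltnW /leq_trans -> //; apply: leq_bigmax.
(* Products with exponents below [N] have degree at most [r * d * N < c * N], so their exponents lie
   in a box of side [c * N]. The choice of [N] gives [(c * N) ^ m < N ^ m.+1 <= N ^ r]. *)
pose c := (r * d).+1; pose N := (c ^ m).+1.
pose mon k M (b : {ffun 'I_k -> 'I_M}) : 'X_{1..k} := [multinom (b i : nat) | i < k].
have mon_inj k M : injective (@mon k M).
  move=> b1 b2 /mnmP e; apply/ffunP => i; apply: val_inj.
  by have := e i; rewrite !mnmE.
pose A := {ffun 'I_r -> 'I_N}; pose B := {ffun 'I_m -> 'I_(c * N)}.
(* Row [i] lists the coefficients of the [i]-th product; having more rows than columns, [M] has a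
   nonzero left kernel vector, whose entries are the coefficients of the relation. *)
pose M := \matrix_(i < #|A|, j < #|B|)
  (mmap1 y (mon _ _ (enum_val i)))@_(mon _ _ (enum_val j)) : 'M[K]_(_, _).
have ltBA : (#|B| < #|A|)%N.
  rewrite !card_ffun !card_ord expnMn; apply: (@leq_trans (N ^ m.+1)).
    by rewrite expnS ltn_mul2r expn_gt0 ltnSn.
  by rewrite leq_pexp2l.
have: kermx M != 0.
  by rewrite kermx_eq0 /row_free neq_ltn (leq_ltn_trans (rank_leq_col _) ltBA).
move=> /rowV0Pn[u /sub_kermxP uM u0].
exists (\sum_i u 0 i *: 'X_[mon _ _ (enum_val i)]).
  apply: contraNneq u0 => p0; apply/eqP/rowP => i0; rewrite mxE.
  have /mpolyP/(_ (mon _ _ (enum_val i0))) := p0.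
  rewrite mcoeff0 raddf_sum (bigD1 i0) //= big1 => [|i ni].
    by rewrite addr0 mcoeffZ mcoeffX eqxx mulr1.
  by rewrite mcoeffZ mcoeffX (inj_eq (@mon_inj _ _)) (inj_eq enum_val_inj) (negbTE ni) mulr0.
rewrite raddf_sum; apply/mpolyP => b; rewrite mcoeff0 raddf_sum /=.
under eq_bigr => i _ do rewrite mmapZ mmapX mcoeffCM.
case: (boolP [forall j, (b j < c * N)%N]) => [/forallP bN|/forallPn[j nbj]].
  pose b' : B := [ffun j => Ordinal (bN j)].
  have bE : b = mon _ _ (enum_val (enum_rank b')).
    by rewrite enum_rankK; apply/mnmP => j; rewrite mnmE ffunE.
  have /rowP/(_ (enum_rank b')) := uM; rewrite !mxE => e; rewrite -[RHS]e.
  by apply: eq_bigr => i _; rewrite !mxE -bE.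
rewrite big1 // => i _; rewrite (@memN_msupp_eq0 _ _ _ b) ?mulr0 //.
apply: contra nbj => /(@deg_le_mmap1 d N) bd.
have {}bd : (mdeg b <= r * (d * N))%N by apply: bd => // k; rewrite mnmE ltnW.
apply: (@leq_ltn_trans (mdeg b)); first by rewrite mdegE (bigD1 j) //= leq_addr.
by apply: leq_ltn_trans bd _; rewrite mulnA /c mulSn addnC -ltn_subLR ?leqnn // subnn.
Qed.

End Dependence.

(** Going down the chain, each strict inclusion contributes one more polynomial. At the bottom,
    [d + k] polynomials are independent modulo a prime, hence over [K], and [mpoly_dependent]
    applies. *)
Lemma prime_chain_bound (K : fieldType) m (P : {mpoly K[m]} -> Prop) (v : nat -> {mpoly K[m]})
    d k :
  (forall p : Defs.mpoly K d, P (Defs.meval (@mpolyC m K) v p) -> p = 0) ->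
  prime_chain_to P k -> (d + k <= m)%N.
Proof.
move=> vind [Q [Qpr [Qinc Qk]]].
have ind j : (j <= k)%N -> exists w, forall p : Defs.mpoly K (d + j),
    Q (k - j)%N (Defs.meval (@mpolyC m K) w p) -> p = 0.
  elim: j => [_|j IH ltjk].
    by rewrite addn0 subn0; exists v => p /Qk; apply: vind.
  have [w wind] := IH (ltnW ltjk).
  have [kjpr _] := Qpr (k - j)%N (leq_subr _ _).
  rewrite -subnSK // in wind kjpr.
  have ltk : (k - j.+1 < k)%N by rewrite ltn_subrL (leq_trans _ ltjk).
  have [sub [f [Qf nQf]]] := Qinc _ ltk.
  by rewrite addnS; apply: alg_indep_extend (Qpr _ (ltnW ltk)) kjpr sub Qf nQf wind.
have [w wind] := ind k (leqnn _); rewrite subnn in wind.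
rewrite leqNgt; apply/negP => ltm.
have [p p0 yp0] := mpoly_dependent (fun i : 'I_(d + k) => w i) ltm.
have [f [g [fE fK gK gC gX]]] := iter_poly_mpoly_iso K (d + k).
have [e eE] := meval_rmorphism (@mpolyC m K) w (d + k).
have gp0 : g p = 0.
  apply: wind; suff -> : Defs.meval (@mpolyC m K) w (g p) = 0.
    by have [[]] := Qpr 0%N (leq0n _).
  rewrite -eE -yp0.
  apply: (@mpoly_ext _ _ _ (e \o g) (mmap (@mpolyC m K) (fun i : 'I_(d + k) => w i))).
    by move=> x /=; rewrite gC eE mevalC [RHS]mmapC.
  by move=> i /=; rewrite gX eE mevalX // [RHS]mmapX mmap1U.
by move: p0; rewrite -(gK p) gp0 rmorph0 eqxx.
Qed.

(** * Toric maps *)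

Section LinearExtension.

Variables (K : fieldType) (m : nat) (V : lmodType K) (F : 'X_{1..m} -> V).

Definition linext (p : {mpoly K[m]}) : V := \sum_(b <- msupp p) p@_b *: F b.

Lemma linextE k p : (msize p <= k)%N ->
  linext p = \sum_(b : 'X_{1..m < k}) p@_b *: F b.
Proof.
move=> pk; pose I : subFinType _ := 'X_{1..m < k}.
rewrite /linext (big_mksub I) ?msupp_uniq //=; last first.
  by move=> x /msize_mdeg_lt /leq_trans; apply.
by rewrite big_rmcond //= => i /memN_msupp_eq0 ->; rewrite scale0r.
Qed.

Lemma linext_is_linear : linear linext.
Proof.
(* A common degree bound lets the three sums run over one finite index set. *)
move=> c p q; pose k := maxn (msize (c *: p + q)) (maxn (msize p) (msize q)).
rewrite !(@linextE k) /k ?leq_max ?leqnn ?orbT // scaler_sumr -big_split /=.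
by apply: eq_bigr => b _; rewrite mcoeffD mcoeffZ scalerDl scalerA.
Qed.

HB.instance Definition _ := GRing.isLinear.Build K {mpoly K[m]} V _ linext linext_is_linear.

Lemma linextX b : linext 'X_[b] = F b.
Proof. by rewrite /linext msuppX big_seq1 mcoeffX eqxx scale1r. Qed.

End LinearExtension.

Definition expv n (b : 'X_{1..n}) : 'rV[rat]_n := \row_i (b i)%:R.

Lemma expv_inj n : injective (@expv n).
Proof.
move=> b c /rowP e; apply/mnmP => i; have := e i; rewrite !mxE => /eqP.
by rewrite eqr_nat => /eqP.
Qed.

Lemma expvD n (b c : 'X_{1..n}) : expv (b + c)%MM = expv b + expv c.
Proof. by apply/rowP => i; rewrite !mxE mnmDE natrD. Qed.

Lemma clear_denominators m (v : 'rV[rat]_m) :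
  exists N, exists b c : 'X_{1..m}, (0 < N)%N /\ N%:R *: v = expv b - expv c.
Proof.
pose D i := absz (denq (v 0 i)).
(* This is [v 0 i] times the product of all denominators; [b] and [c] will be the positive and
   negative parts of [z]. *)
pose z i : int := numq (v 0 i) * (\prod_(j | j != i) D j)%:Z.
exists (\prod_i D i)%N.
exists [multinom (if z i is Posz k then k else 0%N) | i < m].
exists [multinom (if z i is Negz k then k.+1 else 0%N) | i < m].
split; first by apply: prodn_gt0 => i; rewrite absz_gt0 denq_neq0.
apply/rowP => i; rewrite !mxE !mnmE (bigD1 i) //=.
transitivity ((z i)%:~R : rat); last first.
  by case: (z i) => k; rewrite ?subr0 // NegzE sub0r mulrNz.
have DE : (denq (v 0 i))%:~R = (D i)%:R :> rat by rewrite -[in LHS]absz_denq.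
by rewrite /z intrM numqE DE natrM mulrC mulrA -pmulrn.
Qed.

Section Toric.

Variables (K : fieldType) (m n : nat) (a : 'I_m -> 'X_{1..n}).

Definition toric_exp (b : 'X_{1..m}) : 'X_{1..n} := (\sum_(i < m) a i *+ b i)%MM.

Definition toric_mor (p : {mpoly K[m]}) : {mpoly K[n]} :=
  mmap (@mpolyC n K) (fun i => 'X_[a i]) p.

HB.instance Definition _ :=
  GRing.RMorphism.copy toric_mor (mmap (@mpolyC n K) (fun i => 'X_[a i])).

Definition exp_matrix : 'M[rat]_(m, n) := \matrix_(i, j) (a i j)%:R.

Lemma toric_morC c : toric_mor c%:MP = c%:MP.
Proof. exact: mmapC. Qed.

Lemma toric_morX b : toric_mor 'X_[b] = 'X_[toric_exp b].
Proof. by rewrite [LHS]mmapX /mmap1 mprodXnE. Qed.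

Lemma toric_expE b j : toric_exp b j = (\sum_i a i j * b i)%N.
Proof. by rewrite mnm_sumE; apply: eq_bigr => i _; rewrite mulmnE. Qed.

Lemma toric_expv b : expv (toric_exp b) = expv b *m exp_matrix.
Proof.
apply/rowP => j; rewrite !mxE toric_expE natr_sum; apply: eq_bigr => i _.
by rewrite !mxE natrM mulrC.
Qed.

Lemma toric_exp_eqP b c :
  toric_exp b = toric_exp c <-> (expv b - expv c) *m exp_matrix = 0.
Proof.
rewrite mulmxBl -!toric_expv; split=> [->|/eqP]; first by rewrite subrr.
by rewrite subr_eq0 => /eqP/expv_inj.
Qed.

Lemma toric_mor_linext p : toric_mor p = linext (fun b => 'X_[toric_exp b]) p.
Proof.
rewrite [in LHS](mpolyE p) rmorph_sum; apply: eq_bigr => b _.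
by rewrite -!mul_mpolyC rmorphM /= toric_morC toric_morX.
Qed.

Lemma toric_mor_coef p g :
  (toric_mor p)@_g = \sum_(b <- msupp p | toric_exp b == g) p@_b.
Proof.
rewrite toric_mor_linext raddf_sum /= [RHS]big_mkcond; apply: eq_bigr => b _.
by rewrite mcoeffZ mcoeffX; case: eqP; rewrite ?mulr1 ?mulr0.
Qed.

Lemma toric_mor_inj : injective toric_exp -> injective toric_mor.
Proof.
move=> einj; apply: raddf_inj => p p0; apply/mpolyP => b; rewrite mcoeff0.
case: (boolP (b \in msupp p)) => [bp|/memN_msupp_eq0 //].
have := toric_mor_coef p (toric_exp b); rewrite p0 mcoeff0 => /esym.
rewrite big_mkcond (bigD1_seq b) ?msupp_uniq //= eqxx big1 ?addr0 // => c /negP ncb.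
by case: eqP => // /einj /eqP.
Qed.

Definition toric_ker (p : {mpoly K[m]}) : Prop := toric_mor p = 0.

Lemma toric_ker_prime : is_prime_ideal toric_ker.
Proof. exact: prime_ideal_ker. Qed.

Lemma toric_ker_ideal : is_ideal toric_ker.
Proof. by case: toric_ker_prime. Qed.

Lemma toric_ker_binomial b c :
  toric_ker ('X_[b] - 'X_[c]) <-> toric_exp b = toric_exp c.
Proof.
rewrite /toric_ker rmorphB /= !toric_morX; split=> [|->]; last by rewrite subrr.
move=> /(congr1 (mcoeff (toric_exp c))); rewrite mcoeffB mcoeff0 !mcoeffX eqxx.
by case: eqP => // _ /eqP; rewrite sub0r oppr_eq0 oner_eq0.
Qed.

(** When [F] depends only on the fiber, its linear extension factors through the toric map. *)
Lemma toric_ker_linext (V : lmodType K) (F : 'X_{1..m} -> V) (h : 'X_{1..n} -> V) p :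
  {in msupp p, forall b, F b = h (toric_exp b)} -> toric_ker p -> linext F p = 0.
Proof.
move=> Fh p0; transitivity (linext h (toric_mor p)); last by rewrite p0 raddf0.
rewrite toric_mor_linext [linext _ p in RHS]/linext linear_sum /linext.
by apply: eq_big_seq => b /Fh ->; rewrite linearZ_LR /= linextX.
Qed.

(** Picks the first exponent of the support lying over [g]; the default 0 occurs only for fibers
    that miss the support. *)
Definition fiber_repr (p : {mpoly K[m]}) (g : 'X_{1..n}) : 'X_{1..m} :=
  nth 0%MM (msupp p) (find (fun b => toric_exp b == g) (msupp p)).

Lemma fiber_reprE p b : b \in msupp p -> toric_exp (fiber_repr p (toric_exp b)) = toric_exp b.
Proof.
move=> bp; apply/eqP; apply: (@nth_find _ _ (fun c => toric_exp c == toric_exp b)).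
by apply/hasP; exists b => /=.
Qed.

(** The coefficients of [p] sum to 0 on every fiber, so the representatives, weighted by these
    coefficients, cancel and may be subtracted freely. *)
Lemma toric_ker_binomials p : toric_ker p ->
  p = \sum_(b <- msupp p) p@_b *: ('X_[b] - 'X_[fiber_repr p (toric_exp b)]).
Proof.
move=> p0; under eq_bigr => b _ do rewrite scalerBr.
rewrite sumrB -mpolyE.
have := @toric_ker_linext _ (fun b => 'X_[fiber_repr p (toric_exp b)])
  (fun g => 'X_[fiber_repr p g]) p.
by rewrite /linext => -> //; rewrite subr0.
Qed.

End Toric.

Arguments toric_mor K {m n} a p.
Arguments toric_ker K {m n} a p.

(** Reduces inclusions of toric ideals to comparing the partitions of exponents into fibers. *)
Lemma toric_ker_sub (K : fieldType) m n n' (a : 'I_m -> 'X_{1..n}) (a' : 'I_m -> 'X_{1..n'}) p :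
  (forall b c, toric_exp a b = toric_exp a c -> toric_exp a' b = toric_exp a' c) ->
  toric_ker K a p -> toric_ker K a' p.
Proof.
move=> aa' pa; rewrite /toric_ker toric_mor_linext.
apply: (toric_ker_linext (h := fun g => 'X_[toric_exp a' (fiber_repr a p g)])) pa.
by move=> b bp; rewrite (aa' _ _ (fiber_reprE a bp)).
Qed.

(** * Height of a toric ideal *)

Section ToricHeight.

Variables (K : fieldType) (m n : nat) (a : 'I_m -> 'X_{1..n}).

Local Notation A := (exp_matrix a).
Local Notation d := (\rank A).

Lemma toric_exp_rowsub_inj r (f : 'I_r -> 'I_m) :
  row_free (rowsub f A) -> injective (toric_exp (a \o f)).
Proof.
have -> : rowsub f A = exp_matrix (a \o f) by apply/matrixP => i j; rewrite !mxE.
move=> rf b c /(congr1 (@expv _)); rewrite !toric_expv => /(row_free_inj rf).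
exact: expv_inj.
Qed.

(** The variables of a row basis of the exponent matrix are independent modulo the toric ideal,
    because the toric map is injective on their monomials. *)
Lemma toric_chain_bound k : prime_chain_to (toric_ker K a) k -> (d + k <= m)%N.
Proof.
pose f := maxrankfun A; pose v i := if insub i is Some j then 'X_(f j) else 0 : {mpoly K[m]}.
apply: (@prime_chain_bound _ _ _ v) => p.
have [phi [psi [phiE phiK _ _ _]]] := iter_poly_mpoly_iso K d.
have [e eE] := meval_rmorphism (@mpolyC m K) v d.
rewrite -eE /toric_ker.
have -> : toric_mor K a (e p) = toric_mor K (a \o f) (phi p).
  apply: (@iter_poly_ext _ _ _ (toric_mor K a \o e) (toric_mor K (a \o f) \o phi)).
    by move=> x /=; rewrite eE phiE !mevalC !toric_morC.
  move=> i lti /=; rewrite eE phiE !mevalX // /v /var_or0 insubT.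
  by rewrite [LHS]mmapX [RHS]mmapX !mmap1U.
have inj : injective (toric_mor K (a \o f)).
  apply/toric_mor_inj/toric_exp_rowsub_inj.
  exact: maxrowsub_free.
by rewrite -(rmorph0 (toric_mor K (a \o f))) => /inj e0; rewrite -(phiK p) e0 rmorph0.
Qed.

End ToricHeight.

Section ToricChain.

Variables (K : fieldType) (m n : nat) (a : 'I_m -> 'X_{1..n}).

Local Notation A := (exp_matrix a).

(* Tagging the variables in [U] by fresh independent ones. The kernels of the resulting
   toric maps, for a shrinking set [U], form the prime chain below the toric ideal. *)
Definition tagged (U : seq 'I_m) (i : 'I_m) : 'X_{1..n + m} :=
  [multinom (match split j with inl j => a i j | inr k => (k == i) && (i \in U) end) | j < n + m].

Lemma toric_exp_taggedP U b c :
  toric_exp (tagged U) b = toric_exp (tagged U) c <->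
  toric_exp a b = toric_exp a c /\ {in U, b =1 c}.
Proof.
have expl e j : toric_exp (tagged U) e (lshift m j) = toric_exp a e j.
  by rewrite !toric_expE; apply: eq_bigr => i _; rewrite mnmE (unsplitK (inl j)).
have expr e k : toric_exp (tagged U) e (rshift n k) = if k \in U then e k else 0%N.
  rewrite toric_expE (bigD1 k) //= big1 => [|i nik].
    by rewrite mnmE (unsplitK (inr k)) eqxx addn0; case: (k \in U); rewrite ?mul1n.
  by rewrite mnmE (unsplitK (inr k)) eq_sym (negbTE nik).
split=> [/mnmP e|[/mnmP e eU]].
  split=> [|k kU]; first by apply/mnmP => j; rewrite -!expl.
  by have := e (rshift n k); rewrite !expr kU.
apply/mnmP => j; rewrite -(splitK j); case: (split j) => k /=; first by rewrite !expl.
by rewrite !expr; case: ifP => // /eU.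
Qed.

Lemma toric_chain : prime_chain_to (toric_ker K a) (m - \rank A).
Proof.
pose f := maxrankfun A; pose s := [seq i <- enum 'I_m | i \notin codom f].
have sz_s : size s = (m - \rank A)%N.
  have c1 : #|codom f| = \rank A by rewrite card_codom ?card_ord //; apply: maxrankfun_inj.
  have c2 : size s = #|[predC codom f]| by rewrite cardE /s enumT /enum_mem.
  by rewrite -[LHS](addKn (\rank A)) c2 -[X in (X + _)%N]c1 cardC card_ord.
exists (fun j => toric_ker K (tagged (drop j s))); rewrite -sz_s; split=> [j _|].
  exact: toric_ker_prime.
split=> [j ltj|p]; last first.
  by rewrite drop_size; split; apply: toric_ker_sub => b c; rewrite toric_exp_taggedP // => -[].
split=> [p|].
  apply: toric_ker_sub => b c; rewrite !toric_exp_taggedP => -[-> bc]; split=> // i.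
  by rewrite -add1n -drop_drop => /mem_drop /bc.
(* [i0] serves as the default element for [nth]. *)
have /hasP[i0 _ _] : has predT s by rewrite has_predT (leq_ltn_trans _ ltj).
have s_uniq : uniq s by rewrite filter_uniq ?enum_uniq.
have dropE := drop_nth i0 ltj; set i := nth i0 s j in dropE.
have is_s : i \in s by rewrite mem_nth.
have s_nf l : l \in s -> l \notin codom f by rewrite mem_filter => /andP[].
have ni : i \notin drop j.+1 s.
  by have := drop_uniq j s_uniq; rewrite dropE /= => /andP[].
have /submxP[w wE] : (row i A <= rowsub f A)%MS by rewrite eq_maxrowsub row_sub.
(* The relation writing row [i] through the basis rows. Off the basis it is supported at [i] alone,
   so its binomial respects all remaining tags and violates only the tag of [i]. *)
pose v := delta_mx 0 i - w *m rowsub f 1%:M : 'rV[rat]_m.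
have vA : v *m A = 0.
  by rewrite mulmxBl -rowE wE -mulmxA mul_rowsub_mx mul1mx subrr.
have vE l : l \notin codom f -> v 0 l = (l == i)%:R.
  move=> nl; rewrite !mxE eqxx big1 ?subr0 // => k _; rewrite !mxE.
  by case: eqP => [fk|]; rewrite ?mulr0 //; rewrite -fk codom_f in nl.
have [N [b [c [N0 Nv]]]] := clear_denominators v.
have bc : toric_exp a b = toric_exp a c.
  by apply/toric_exp_eqP; rewrite -Nv -scalemxAl vA scaler0.
have bcE l : l \notin codom f -> (b l == c l) = (l != i).
  move=> /vE vl; move/rowP/(_ l): Nv; rewrite mxE vl !mxE => e.
  rewrite -(eqr_nat rat) -subr_eq0 -e mulf_eq0 pnatr_eq0 (gtn_eqF N0) /=.
  by case: (l == i); rewrite ?eqxx ?oner_eq0.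
exists ('X_[b] - 'X_[c]); split.
  apply/toric_ker_binomial/toric_exp_taggedP; split=> // l ls; apply/eqP; rewrite bcE.
    by apply: contraNneq ni => <-.
  by apply: s_nf; apply: mem_drop ls.
move=> /toric_ker_binomial/toric_exp_taggedP[_] /(_ i).
by rewrite dropE mem_head => /(_ isT) /eqP; rewrite bcE ?eqxx //; apply: s_nf.
Qed.

Lemma toric_height : ideal_height (toric_ker K a) (m - \rank A).
Proof.
apply: ideal_height_prime; [exact: toric_ker_prime|exact: toric_chain|].
by move/toric_chain_bound; rewrite addnS subnKC ?rank_leq_row // ltnn.
Qed.

Lemma toric_height_uniq h : ideal_height (toric_ker K a) h -> h = (m - \rank A)%N.
Proof.
move=> Ih; apply: ideal_height_prime_uniq Ih _ _; [exact: toric_ker_prime|exact: toric_chain|].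
by move/toric_chain_bound; rewrite addnS subnKC ?rank_leq_row // ltnn.
Qed.

End ToricChain.

(** * Minimal generators *)

Section IdealSpan.

Variable R : comNzRingType.

Definition ideal_span r (b : 'I_r -> R) (f : R) : Prop :=
  exists c : 'I_r -> R, f = \sum_i c i * b i.

Lemma ideal_span_ideal r (b : 'I_r -> R) : is_ideal (ideal_span b).
Proof.
split; first by exists (fun=> 0); rewrite big1 // => i _; rewrite mul0r.
split=> [f g [c ->] [d ->]|x f [c ->]].
  by exists (fun i => c i + d i); rewrite -big_split; apply: eq_bigr => i _; rewrite mulrDl.
by exists (fun i => x * c i); rewrite mulr_sumr; apply: eq_bigr => i _; rewrite mulrA.
Qed.

Lemma ideal_span_gen r (b : 'I_r -> R) i : ideal_span b (b i).
Proof.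
exists (fun j => (j == i)%:R); rewrite (bigD1 i) //= eqxx mul1r big1 ?addr0 // => j.
by move=> /negbTE ->; rewrite mul0r.
Qed.

Lemma idealB (I : R -> Prop) f g : is_ideal I -> I f -> I g -> I (f - g).
Proof. by move=> [_ [ID IM]] If Ig; apply: ID => //; rewrite -mulN1r; apply: IM. Qed.

End IdealSpan.

Section GradedNakayama.

Variables (K : fieldType) (m : nat).
Local Notation R := {mpoly K[m]}.
Implicit Types (I : R -> Prop) (f g p : R).

(** For an ideal [I], the product of [I] with the ideal generated by the variables. *)
Definition vars_mul I f : Prop :=
  exists F : 'I_m -> R, (forall k, I (F k)) /\ f = \sum_k 'X_k * F k.

Lemma vars_mul_ideal I : is_ideal I -> is_ideal (vars_mul I).
Proof.
move=> [I0 [ID IM]]; split; first by exists (fun=> 0); rewrite big1 // => k _; rewrite mulr0.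
split=> [f g [F [IF ->]] [G [IG ->]]|x f [F [IF ->]]].
  exists (fun k => F k + G k); split=> [k|]; first exact: ID.
  by rewrite -big_split; apply: eq_bigr => k _; rewrite mulrDr.
exists (fun k => x * F k); split=> [k|]; first exact: IM.
by rewrite mulr_sumr; apply: eq_bigr => k _; rewrite mulrCA.
Qed.

(** Every nonconstant monomial of [p] has a variable to split off, the cofactor times [f] staying in
    [I]. *)
Lemma vars_mul_const I p f : is_ideal I -> I f -> vars_mul I (p * f - p@_0%MM *: f).
Proof.
move=> II If; have [M0 [MD MM]] := vars_mul_ideal II.
elim/mpolyind: p => [|c b p _ _ IHp]; first by rewrite mul0r mcoeff0 scale0r subrr.
rewrite mcoeffD mcoeffZ mulrDl scalerDl opprD addrACA; apply: MD => //.
rewrite -scalerAl -scalerA -scalerBr -[X in vars_mul _ X]mul_mpolyC; apply: MM.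
rewrite mcoeffX; case: eqP => [->|/eqP nb0].
  by rewrite mpolyX0 mul1r scale1r subrr.
rewrite scale0r subr0; have [k bk] : exists k, b k != 0%N.
  apply/existsP; apply: contraNT nb0 => /existsPn b0; apply/eqP/mnmP => k.
  by rewrite mnm0E; have := b0 k; rewrite negbK => /eqP.
exists (fun l => if l == k then 'X_[b - U_(k)] * f else 0); split=> [l|].
  by case: II => I0 [_ IM]; case: eqP => // _; apply: IM.
rewrite (bigD1 k) //= eqxx big1 => [|l /negbTE ->]; last by rewrite mulr0.
by rewrite addr0 mulrA -mpolyXD addmC submK // lep1mP.
Qed.

(* Modulo [vars_mul I] only the constant terms of coefficients matter, so that a
   maximal set of independent rows of constant terms picks the generators. *)
Lemma generators_mod_vars_mul I (gs : seq R) N (b : 'I_N -> R) :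
  is_ideal I -> generated_by gs I -> (forall i, I (b i)) ->
  (forall f, I f -> ideal_span b f) ->
  exists r, exists s : 'I_r -> 'I_N, (r <= size gs)%N /\
    forall f, I f -> exists2 g, ideal_span (b \o s) g & vars_mul I (f - g).
Proof.
move=> II gsI Ib spanb; have IM := vars_mul_ideal II; have [_ [MD MM]] := IM.
have MZ (c : K) f : vars_mul I f -> vars_mul I (c *: f).
  by rewrite -mul_mpolyC; apply: MM.
pose g (j : 'I_(size gs)) : R := gs`_j.
have /fin_all_exists[cs csE] : forall i, exists c : seq R, b i = \sum_(j < size gs) c`_j * g j.
  by move=> i; have /gsI[c [_ ->]] := Ib i; exists c.
pose C := \matrix_(i < N, j < size gs) ((cs i)`_j)@_0%MM.
have bC i : vars_mul I (b i - \sum_j C i j *: g j).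
  rewrite [b i]csE -sumrB; apply: ideal_sum => // j _; rewrite mxE.
  by apply: vars_mul_const => //; apply: generated_by_in.
pose s := maxrankfun C.
(* The matrix [D] that writes the rows of [C] through the picked ones also writes each [b i] through
   the [b (s k)], modulo [vars_mul I]. *)
have /submxP[D DE] : (C <= rowsub s C)%MS by rewrite eq_maxrowsub.
have bD i : vars_mul I (b i - \sum_k D i k *: b (s k)).
  have -> : b i - \sum_k D i k *: b (s k) = (b i - \sum_j C i j *: g j)
      - \sum_k D i k *: (b (s k) - \sum_j C (s k) j *: g j).
    have -> : \sum_k D i k *: (b (s k) - \sum_j C (s k) j *: g j) =
        \sum_k D i k *: b (s k) - \sum_k D i k *: \sum_j C (s k) j *: g j.
      by rewrite -sumrB; apply: eq_bigr => k _; rewrite scalerBr.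
    suff -> : \sum_j C i j *: g j =
      \sum_k D i k *: \sum_j C (s k) j *: g j by rewrite opprB addrA subrK.
    under [RHS]eq_bigr => k _ do rewrite scaler_sumr.
    rewrite exchange_big; apply: eq_bigr => j _ /=.
    rewrite [in LHS]DE mxE scaler_suml; apply: eq_bigr => k _.
    by rewrite scalerA [rowsub s C k j]mxE.
  by apply: idealB => //; apply: ideal_sum => // k _; apply: MZ.
exists (\rank C), s; split=> [|f /spanb[c ->]]; first exact: rank_leq_col.
exists (\sum_i c i * \sum_k D i k *: b (s k)); last first.
  by rewrite -sumrB; apply: ideal_sum => // i _; rewrite -mulrBr; apply: MM.
have JI := ideal_span_ideal (b \o s); have [_ [_ JM]] := JI.
apply: ideal_sum => // i _; apply: (JM); apply: ideal_sum => // k _.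
by rewrite -mul_mpolyC; apply: JM; apply: (ideal_span_gen (b \o s)).
Qed.

Variable w : 'I_m -> nat.

(** Encodes the grading with weights [w]: the [k]-th coefficient of the image is the component of
    weight [k], and evaluation at 1 recovers [p]. *)
Definition weight_mor (p : R) : {poly R} :=
  mmap (@polyC R \o @mpolyC m K) (fun i => ('X_i)%:P * 'X^(w i)) p.

HB.instance Definition _ := GRing.RMorphism.copy weight_mor
  (mmap (@polyC R \o @mpolyC m K) (fun i => ('X_i)%:P * 'X^(w i))).

Lemma weight_morXi i : weight_mor 'X_i = ('X_i)%:P * 'X^(w i).
Proof. by rewrite [LHS]mmapX mmap1U. Qed.

Lemma weight_morX b : weight_mor 'X_[b] = ('X_[b])%:P * 'X^(\sum_i w i * b i).
Proof.
rewrite [LHS]mmapX /mmap1 [in RHS]mpolyXE_id rmorph_prod -prodrXr -big_split /=.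
by apply: eq_bigr => i _; rewrite exprMn rmorphXn -exprM.
Qed.

Lemma weight_mor1 p : (weight_mor p).[1] = p.
Proof.
apply: (@mpoly_ext _ _ _ (horner_eval 1 \o weight_mor) idfun) => [c|i] /=.
  by rewrite [weight_mor _]mmapC /horner_eval hornerC.
by rewrite weight_morXi /horner_eval hornerM hornerC hornerXn expr1n mulr1.
Qed.

(** Strong induction on the weight of a component of [f]. The span part is harmless as the [b s] are
    homogeneous; in the rest, a factor ['X_l] of positive weight leaves a component of smaller
    weight of an element of [I]. *)
Lemma graded_nakayama I r (b : 'I_r -> R) (e : 'I_r -> nat) :
  (forall i, 0 < w i)%N -> (forall s, weight_mor (b s) = (b s)%:P * 'X^(e s)) ->
  (forall f, I f -> exists2 g, ideal_span b g & vars_mul I (f - g)) ->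
  forall f, I f -> ideal_span b f.
Proof.
move=> w0 bhom nak; have JI := ideal_span_ideal b; have [J0 [JD JM]] := JI.
have coefJ k : forall f, I f -> ideal_span b (weight_mor f)`_k.
  elim/ltn_ind: k => k IHk f /nak[g [c gE] [F [IF FE]]].
  rewrite -(subrK g f) FE rmorphD coefD; apply: JD.
    rewrite rmorph_sum coef_sum; apply: ideal_sum => // l _.
    rewrite rmorphM /= weight_morXi -mulrA coefCM coefXnM; apply: JM.
    case: ltnP => // wl; apply: IHk => //.
    by rewrite ltn_subrL w0 (leq_trans (w0 l)).
  rewrite gE rmorph_sum coef_sum; apply: ideal_sum => // s _.
  rewrite rmorphM /= bhom mulrA coefMXn; case: ltnP => // _.
  by rewrite coefMC; apply: JM; apply: ideal_span_gen.
move=> f If; rewrite -(weight_mor1 f) horner_coef; apply: ideal_sum => // k _.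
by rewrite expr1n mulr1; apply: coefJ.
Qed.

End GradedNakayama.

(** * Binomial generators and their exponent differences *)

Section BinomialGenerators.

Variables (K : fieldType) (m n : nat) (a : 'I_m -> 'X_{1..n}).
Local Notation R := {mpoly K[m]}.
Local Notation A := (exp_matrix a).

Definition binomial (bc : 'X_{1..m} * 'X_{1..m}) : R := 'X_[bc.1] - 'X_[bc.2].

Definition diff_matrix r (bc : 'I_r -> 'X_{1..m} * 'X_{1..m}) : 'M[rat]_(r, m) :=
  \matrix_(s < r) (expv (bc s).1 - expv (bc s).2).

(** Collects the binomials into which [toric_ker_binomials] splits each given generator. *)
Lemma toric_binomial_generators (gs : seq R) : generated_by gs (toric_ker K a) ->
  exists N, exists bc : 'I_N -> 'X_{1..m} * 'X_{1..m},
    (forall i, toric_exp a (bc i).1 = toric_exp a (bc i).2) /\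
    forall f, toric_ker K a f -> ideal_span (binomial \o bc) f.
Proof.
move=> gsI; pose B := [seq (b, fiber_repr a g (toric_exp a b)) | g <- gs, b <- msupp g].
pose bc (i : 'I_(size B)) := nth (0%MM, 0%MM) B i.
exists (size B), bc; split=> [i|f].
  have /allpairsPdep[g [b [_ bg ->]]] : bc i \in B by rewrite mem_nth.
  by rewrite /= fiber_reprE.
have JI := ideal_span_ideal (binomial \o bc); have [_ [_ JM]] := JI.
move=> /gsI[cs [_ ->]]; apply: ideal_sum => // i _; apply: (JM).
rewrite (toric_ker_binomials (generated_by_in gsI (ltn_ord i))) big_seq.
apply: ideal_sum => // b bg; rewrite -mul_mpolyC; apply: (JM).
have bB : (b, fiber_repr a gs`_i (toric_exp a b)) \in B.
  by apply/allpairsPdep; exists gs`_i, b; rewrite mem_nth.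
have iB := bB; rewrite -index_mem in iB.
have := ideal_span_gen (binomial \o bc) (Ordinal iB).
by rewrite /binomial /bc /= nth_index.
Qed.

(** The grading is the degree of the image monomial: both terms of a binomial share a fiber, hence a
    weight, and [a i != 0] makes the weights positive. *)
Lemma toric_few_binomial_generators (gs : seq R) :
  (forall i, a i != 0%MM) -> generated_by gs (toric_ker K a) ->
  exists r, exists bc : 'I_r -> 'X_{1..m} * 'X_{1..m},
    [/\ (r <= size gs)%N, forall s, toric_exp a (bc s).1 = toric_exp a (bc s).2 &
    forall f, toric_ker K a f -> ideal_span (binomial \o bc) f].
Proof.
move=> a0 gsI; have [N [bc [bcE bcI]]] := toric_binomial_generators gsI.
have Ib i : toric_ker K a (binomial (bc i)) by apply/toric_ker_binomial.
have [r [s [rg nak]]] := generators_mod_vars_mul (toric_ker_ideal K a) gsI Ib bcI.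
exists r, (bc \o s); split=> // [i|]; first exact: bcE.
apply: (@graded_nakayama _ _ (mdeg \o a) _ _ _ (fun i => mdeg (toric_exp a (bc (s i)).1))) => //.
  by move=> i /=; rewrite lt0n mdeg_eq0.
have wE (b : 'X_{1..m}) : (\sum_i mdeg (a i) * b i)%N = mdeg (toric_exp a b).
  by rewrite mdeg_sum; apply: eq_bigr => i _; rewrite mdegMn.
by move=> i; rewrite /= /binomial !rmorphB /= !weight_morX /= !wE -bcE -mulrBl.
Qed.

(** The functional [linext (F v)] adds the coefficients of monomials with exponent in one coset of
    the row space of [U]. It kills monomial multiples of the generators, whose two terms share a
    coset; on the coset of [b] this forces [c] into it. *)
Lemma ideal_span_diff r (bc : 'I_r -> 'X_{1..m} * 'X_{1..m}) b c :
  ideal_span (binomial \o bc) ('X_[b] - 'X_[c]) -> (expv b - expv c <= diff_matrix bc)%MS.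
Proof.
set U := diff_matrix bc; move=> [g gE].
pose F (v : 'rV[rat]_m) (e : 'X_{1..m}) := (expv e *m cokermx U == v)%:R : K^o.
have F0 v : linext (F v) ('X_[b] - 'X_[c]) = 0.
  rewrite gE linear_sum big1 // => s _ /=.
  rewrite [g s]mpolyE mulr_suml linear_sum big1 // => e _ /=.
  rewrite -scalerAl linearZ_LR /= mulrBr -!mpolyXD linearB /= !linextX.
  suff -> : F v (e + (bc s).1)%MM = F v (e + (bc s).2)%MM by rewrite subrr scaler0.
  rewrite /F !expvD !mulmxDl.
  suff -> : expv (bc s).1 *m cokermx U = expv (bc s).2 *m cokermx U by [].
  apply/eqP; rewrite -subr_eq0 -mulmxBl.
  have <- : row s U = expv (bc s).1 - expv (bc s).2 by rewrite rowK.
  by rewrite -row_mul mulmx_coker row0.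
have := F0 (expv b *m cokermx U); rewrite linearB /= !linextX /F eqxx.
rewrite submxE mulmxBl; case: eqP => [->|_ /eqP]; first by rewrite !subrr.
by rewrite subr0 oner_eq0.
Qed.

(** An integral multiple of each kernel vector of [A] gives a binomial of the ideal, so the [r] rows
    span a space of dimension [m - \rank A >= r]. *)
Lemma diff_matrix_free r (bc : 'I_r -> 'X_{1..m} * 'X_{1..m}) :
  (r <= m - \rank A)%N ->
  (forall f, toric_ker K a f -> ideal_span (binomial \o bc) f) -> row_free (diff_matrix bc).
Proof.
move=> rm bcI; rewrite /row_free eqn_leq rank_leq_row (leq_trans rm) //.
rewrite -mxrank_ker; apply/mxrankS/row_subP => i.
have [N [b [c [N0 Nv]]]] := clear_denominators (row i (kermx A)).
have N0' : (N%:R : rat) != 0 by rewrite pnatr_eq0 -lt0n.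
rewrite -(eqmx_scale _ N0') Nv; apply/ideal_span_diff/bcI/toric_ker_binomial.
by apply/toric_exp_eqP; rewrite -Nv -scalemxAl -row_mul mulmx_ker row0 scaler0.
Qed.

End BinomialGenerators.

(** A complete intersection asks for exactly [h] generators, so a shorter list is filled up with
    zeros. *)
Lemma generated_by_padded (R : comNzRingType) (I : R -> Prop) k h (b : 'I_k -> R) :
  (k <= h)%N -> is_ideal I -> (forall t, I (b t)) -> (forall f, I f -> ideal_span b f) ->
  exists gs : seq R, size gs = h /\ generated_by gs I.
Proof.
move=> kh II Ib bI; pose pad (c : 'I_k -> R) i := if insub i is Some t then c t else 0.
exists (mkseq (pad b) h); rewrite size_mkseq; split=> // f; rewrite size_mkseq; split.
  move=> /bI[c ->]; exists (mkseq (pad c) h); rewrite size_mkseq; split=> //.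
  transitivity (\sum_(i < k) pad c i * pad b i).
    by apply: eq_bigr => i _; rewrite /pad valK.
  rewrite (big_ord_widen h (fun i => pad c i * pad b i)) // big_mkcond /=.
  apply: eq_bigr => i _; rewrite !nth_mkseq //; case: ifP => // ik.
  by rewrite /pad insubF // mul0r.
move=> [cs [_ ->]]; apply: ideal_sum => // i _; have [I0 [_ IM]] := II; apply: IM.
by rewrite nth_mkseq // /pad; case: insub.
Qed.

Lemma rowsub_free (F : fieldType) r k m (U : 'M[F]_(r, m)) (f : 'I_k -> 'I_r) :
  injective f -> row_free U -> row_free (rowsub f U).
Proof.
move=> finj Ufree; rewrite rowsubE /row_free mxrankMfree //.
have : rowsub f 1%:M *m (rowsub f 1%:M)^T = 1%:M :> 'M[F]_k.
  rewrite mul_rowsub_mx mul1mx; apply/matrixP => i j; rewrite !mxE eq_sym.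
  by rewrite (inj_eq finj).
by move=> e; apply/row_freeP; exists (rowsub f 1%:M)^T.
Qed.

(** * Restriction to a face *)

Section Face.

Variables (K : fieldType) (m n m' n' : nat).
Variables (a : 'I_m -> 'X_{1..n}) (a' : 'I_m' -> 'X_{1..n'}).
Variables (io : 'I_m' -> 'I_m) (ka : 'I_n' -> 'I_n).
Hypothesis io_inj : injective io.
(** For graphs, [io] and [ka] embed the edges and vertices of an induced subgraph; [a_face] says
    that any other edge has an endpoint outside. *)
Hypothesis a_in : forall i j, a (io i) (ka j) = a' i j.
Hypothesis a_out : forall i j, j \notin codom ka -> a (io i) j = 0%N.
Hypothesis a_face : forall k, k \notin codom io -> exists2 j, j \notin codom ka & a k j != 0%N.

(** The inclusion of polynomial rings is itself a toric map, with these exponents. *)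
Let a0 (i : 'I_m') : 'X_{1..m} := U_(io i)%MM.

Definition exp_extend : 'X_{1..m'} -> 'X_{1..m} := toric_exp a0.
Definition exp_restrict (b : 'X_{1..m}) : 'X_{1..m'} := [multinom b (io i) | i < m'].
Definition on_face (b : 'X_{1..m}) := [forall k, (k \notin codom io) ==> (b k == 0%N)].

Lemma exp_matrix_extend : exp_matrix a0 = rowsub io 1%:M.
Proof. by apply/matrixP => i j; rewrite !mxE mnm1E. Qed.

Lemma exp_extendK b : on_face b -> exp_extend (exp_restrict b) = b.
Proof.
move=> /forallP bf; apply/mnmP => k; rewrite toric_expE.
case: (boolP (k \in codom io)) => [/codomP[i ->]|nk].
  rewrite (bigD1 i) //= big1 => [|l /negbTE nl]; rewrite /a0 mnm1E.
    by rewrite eqxx mul1n addn0 mnmE.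
  by rewrite (inj_eq io_inj) nl.
have /implyP/(_ nk)/eqP -> := bf k; rewrite big1 // => i _; rewrite mnm1E.
by case: eqP => // ik; rewrite -ik codom_f in nk.
Qed.

Lemma toric_exp_extend b : toric_exp a (exp_extend b) = toric_exp (a \o io) b.
Proof.
apply: expv_inj; rewrite !toric_expv exp_matrix_extend -mulmxA mul_rowsub_mx mul1mx.
by congr (_ *m _); apply/matrixP => i j; rewrite !mxE.
Qed.

Lemma toric_exp_face b c :
  toric_exp (a \o io) b = toric_exp (a \o io) c <-> toric_exp a' b = toric_exp a' c.
Proof.
have inE e j : toric_exp (a \o io) e (ka j) = toric_exp a' e j.
  by rewrite !toric_expE; apply: eq_bigr => i _; rewrite /= a_in.
split=> /mnmP bc; apply/mnmP => j; first by rewrite -!inE.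
case: (boolP (j \in codom ka)) => [/codomP[l ->]|nj]; first by rewrite !inE.
by rewrite !toric_expE !big1 // => i _; rewrite /= a_out.
Qed.

(** Coordinates outside [ka] vanish on the image of [b]; for [c] they are sums of naturals, so each
    term vanishes, and [a_face] rules out exponents off the face. *)
Lemma on_face_fiber b c : toric_exp a b = toric_exp a c -> on_face b -> on_face c.
Proof.
move=> bc /forallP bf; apply/forallP => k; apply/implyP => nk.
have [j nj akj] := a_face nk.
have : toric_exp a c j = 0%N.
  rewrite -bc toric_expE big1 // => l _.
  case: (boolP (l \in codom io)) => [/codomP[i ->]|nl]; first by rewrite a_out.
  by have /implyP/(_ nl)/eqP -> := bf l; rewrite muln0.
move=> /eqP; rewrite toric_expE sum_nat_eq0 => /forallP/(_ k).
by rewrite /= muln_eq0 (negbTE akj).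
Qed.

Definition face_var (k : 'I_m) : {mpoly K[m']} :=
  if [pick i | io i == k] is Some i then 'X_i else 0.

Definition face_retract (p : {mpoly K[m]}) : {mpoly K[m']} := mmap (@mpolyC m' K) face_var p.

HB.instance Definition _ := GRing.RMorphism.copy face_retract (mmap (@mpolyC m' K) face_var).

Lemma face_retract_extend p : face_retract (toric_mor K a0 p) = p.
Proof.
apply: (@mpoly_ext _ _ _ (face_retract \o toric_mor K a0) idfun) => [c|i] /=.
  by rewrite toric_morC [LHS]mmapC.
rewrite [toric_mor _ _ _]mmapX mmap1U [LHS]mmapX mmap1U /face_var.
by case: pickP => [l /eqP/io_inj ->|/(_ i)] //; rewrite eqxx.
Qed.

Lemma face_retractX b : face_retract 'X_[b] = if on_face b then 'X_[exp_restrict b] else 0.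
Proof.
case: ifPn => [bf|/forallPn[k]].
  by rewrite -{1}(exp_extendK bf) /exp_extend -(toric_morX K a0) face_retract_extend.
rewrite negb_imply => /andP[nk bk]; rewrite [LHS]mmapX /mmap1 (bigD1 k) //=.
suff -> : face_var k = 0 by rewrite expr0n (negbTE bk) mul0r.
rewrite /face_var; case: pickP => // i /eqP ik.
by rewrite -ik codom_f in nk.
Qed.

Lemma toric_ker_extend p : toric_ker K a' p -> toric_ker K a (toric_mor K a0 p).
Proof.
move=> pa'; have: toric_ker K (a \o io) p.
  by apply: toric_ker_sub pa' => b c /toric_exp_face.
rewrite /toric_ker => <-.
apply: (@mpoly_ext _ _ _ (toric_mor K a \o toric_mor K a0) (toric_mor K (a \o io))) => [c|i] /=.
  by rewrite !toric_morC.
by rewrite [toric_mor K a0 _]mmapX mmap1U [LHS]mmapX [RHS]mmapX !mmap1U.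
Qed.

Lemma ci_face : (forall i, a i != 0%MM) -> ci_ideal (toric_ker K a) -> ci_ideal (toric_ker K a').
Proof.
move=> an0 [h [/toric_height_uniq -> [gs [sgs gsI]]]].
have [r [bc [rgs bcE bcI]]] := toric_few_binomial_generators an0 gsI.
rewrite sgs in rgs; have Ufree := diff_matrix_free rgs bcI.
(* The generators that survive the retraction; the two terms of a binomial are on the face together
   or not at all. *)
pose T := [set s | on_face (bc s).1].
have bc_face (s : 'I_r) : s \in T -> on_face (bc s).1 /\ on_face (bc s).2.
  by rewrite inE => sT; split=> //; apply: on_face_fiber sT.
pose bc' (t : 'I_#|T|) :=
  (exp_restrict (bc (enum_val t)).1, exp_restrict (bc (enum_val t)).2).
have bc'E t : toric_exp a' (bc' t).1 = toric_exp a' (bc' t).2.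
  have [b1 b2] := bc_face _ (enum_valP t).
  by apply/toric_exp_face; rewrite -!toric_exp_extend !exp_extendK.
have II' : is_ideal (toric_ker K a') := toric_ker_ideal K a'.
have bc'I f : toric_ker K a' f -> ideal_span (@binomial K m' \o bc') f.
  move=> /toric_ker_extend/bcI[c cE]; rewrite -(face_retract_extend f) cE rmorph_sum.
  have JI := ideal_span_ideal (@binomial K m' \o bc'); have [J0 [_ JM]] := JI.
  apply: ideal_sum => // s _; rewrite rmorphM; apply: (JM).
  rewrite /= /binomial rmorphB /= !face_retractX.
  case: (boolP (s \in T)) => [sT|].
    have [b1 b2] := bc_face _ sT; rewrite b1 b2.
    have := ideal_span_gen (@binomial K m' \o bc') (enum_rank_in sT s).
    by rewrite /binomial /bc' /= enum_rankK_in.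
  rewrite inE => nb1; have /negbTE nb2 : ~~ on_face (bc s).2.
    by apply: contra nb1; apply: on_face_fiber.
  by rewrite (negbTE nb1) nb2 subrr.
have cT : (#|T| <= m' - \rank (exp_matrix a'))%N.
  have: row_free (diff_matrix bc').
    (* Extended by zeros, the new differences are rows selected from the independent family
       [diff_matrix bc]. *)
    have: row_free (diff_matrix bc' *m rowsub io 1%:M).
      have -> : diff_matrix bc' *m rowsub io 1%:M =
          rowsub (fun t : 'I_#|T| => enum_val t) (diff_matrix bc).
        apply/row_matrixP => t; rewrite row_rowsub row_mul !rowK mulmxBl -exp_matrix_extend.
        have [b1 b2] := bc_face _ (enum_valP t).
        by rewrite -!toric_expv -/exp_extend !exp_extendK.
      by apply: rowsub_free => //; apply: enum_val_inj.
    rewrite /row_free !eqn_leq !rank_leq_row => /leq_trans; apply.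
    exact: mxrankM_maxl.
  rewrite /row_free -mxrank_ker => /eqP {1}<-; apply: mxrankS.
  apply/row_subP => t; apply/sub_kermxP; rewrite rowK.
  exact/toric_exp_eqP.
exists (m' - \rank (exp_matrix a'))%N; split; first exact: toric_height.
apply: generated_by_padded cT II' _ bc'I => t.
exact/toric_ker_binomial.
Qed.

End Face.

(** * Graphs *)

Section GraphExponents.

Variables (K : fieldType) (V : finType) (adj : rel V).

Definition edge_exp (i : 'I_(nedges adj)) : 'X_{1..#|V|} :=
  [multinom ((enum_val j \in enum_val i) : nat) | j < #|V|].

Lemma edge_expE i v : edge_exp i (enum_rank v) = (v \in enum_val i).
Proof. by rewrite mnmE enum_rankK. Qed.

Lemma edge_monomialE (i : 'I_(nedges adj)) :
  \prod_(v in nth set0 (enum (edges adj)) i) 'X_(enum_rank v) = 'X_[edge_exp i] :> {mpoly K[#|V|]}.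
Proof.
rewrite -enum_val_nth mprodXE; congr 'X_[_]; apply/mnmP => j; rewrite mnm_sumE mnmE.
case: (boolP (enum_val j \in enum_val i)) => jv.
  rewrite (bigD1 (enum_val j)) //= enum_valK mnm1E eqxx big1 // => v /andP[_ nv].
  rewrite mnm1E; case: eqP => // e; by rewrite -e enum_rankK eqxx in nv.
rewrite big1 // => v vi; rewrite mnm1E; case: eqP => // e.
by rewrite -e enum_rankK vi in jv.
Qed.

Lemma toric_idealE (f : {rmorphism Defs.mpoly K (nedges adj) -> {mpoly K[nedges adj]}}) p :
  f =1 Defs.meval (@mpolyC _ K) (@var_or0 K _) ->
  toric_ideal K adj p <-> toric_ker K edge_exp (f p).
Proof.
move=> fE; have [f2 [g2 [f2E f2K _ _ _]]] := iter_poly_mpoly_iso K #|V|.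
have [c cE] := mconst_rmorphism K #|V|.
have [t tE] := meval_rmorphism c (edge_monomial K adj) (nedges adj).
have tmE q : toric_map K adj q = t q by rewrite tE; apply: eq_meval.
suff E : f2 (t p) = toric_mor K edge_exp (f p).
  rewrite /toric_ideal /toric_ker tmE -E; split=> [->|e]; first by rewrite rmorph0.
  by rewrite -(f2K (t p)) e rmorph0.
apply: (@iter_poly_ext _ _ _ (f2 \o t) (toric_mor K edge_exp \o f)) => [x|i lti] /=.
  by rewrite tE mevalC fE mevalC toric_morC cE f2E mevalC.
rewrite tE mevalX // fE mevalX // /var_or0 insubT.
rewrite [RHS]mmapX mmap1U -edge_monomialE /edge_monomial rmorph_prod.
by apply: eq_bigr => v _; rewrite f2E mevalX // /var_or0 valK.
Qed.

Lemma complete_intersectionE :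
  complete_intersection K adj <-> ci_ideal (toric_ker K edge_exp).
Proof.
have [f [g [fE fK gK _ _]]] := iter_poly_mpoly_iso K (nedges adj).
split; last by apply: ci_ideal_iso fK gK _ => p; apply: toric_idealE.
apply: (ci_ideal_iso gK fK) => p.
by rewrite (toric_idealE _ fE) gK.
Qed.

Lemma edge_exp_neq0 i : edge_exp i != 0%MM.
Proof.
have /imset2P[x y _ _ e] := enum_valP i.
apply/eqP => /mnmP/(_ (enum_rank x)).
by rewrite edge_expE e mnm0E set21.
Qed.

End GraphExponents.

(** Allowing any embedding onto an induced subgraph serves both directions of the equivalence. *)
Lemma complete_intersection_embedding (K : fieldType) (V V' : finType)
    (adj : rel V) (adj' : rel V') (phi : V' -> V) :
  injective phi -> (forall x y, adj' x y = adj (phi x) (phi y)) ->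
  complete_intersection K adj -> complete_intersection K adj'.
Proof.
move=> phi_inj adjE; rewrite !complete_intersectionE.
have im_edge (i : 'I_(nedges adj')) : phi @: enum_val i \in edges adj.
  have /imset2P[x y _ + ->] := enum_valP i; rewrite inE adjE => /andP[_ xy].
  by rewrite imsetU1 imset_set1; apply: imset2_f => //; rewrite inE.
pose io (i : 'I_(nedges adj')) : 'I_(nedges adj) := enum_rank_in (im_edge i) (phi @: enum_val i).
have ioE i : enum_val (io i) = phi @: enum_val i by rewrite enum_rankK_in.
pose ka (j : 'I_#|V'|) : 'I_#|V| := enum_rank (phi (enum_val j)).
have kaP v : (enum_rank v \in codom ka) = (v \in codom phi).
  apply/codomP/codomP => [[j /enum_rank_inj ->]|[x ->]]; first by eexists.
  by exists (enum_rank x); rewrite /ka enum_rankK.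
apply: (ci_face (io := io) (ka := ka)) (@edge_exp_neq0 V adj).
- move=> i j e; apply: enum_val_inj; apply: (imset_inj phi_inj).
  by rewrite -!ioE e.
- by move=> i j; rewrite edge_expE ioE mem_imset // mnmE.
- move=> i j; rewrite -(enum_valK j) kaP edge_expE ioE => nj.
  by case: imsetP => // -[x _ jx]; rewrite jx codom_f in nj.
(* If both endpoints came from [V'], the edge would come from an edge of [adj']. *)
move=> k nk; have /imset2P[x y _ + kE] := enum_valP k; rewrite inE => /andP[_ xy].
suff [v vk nv] : exists2 v, v \in enum_val k & v \notin codom phi.
  by exists (enum_rank v); rewrite ?kaP // edge_expE vk.
case: (boolP (x \in codom phi)) => [/codomP[x' xE]|]; last by exists x; rewrite // kE set21.
case: (boolP (y \in codom phi)) => [/codomP[y' yE]|]; last by exists y; rewrite // kE set22.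
have e' : [set x'; y'] \in edges adj'.
  by apply: imset2_f => //; rewrite inE adjE -xE -yE.
case/negP: nk; apply/codomP; exists (enum_rank_in e' [set x'; y']).
apply: enum_val_inj; rewrite ioE enum_rankK_in // kE imsetU1 imset_set1.
by rewrite xE yE.
Qed.

Theorem theorem3p1 (K : fieldType) (V : finType) (adj : rel V) :
  simple_graph adj -> connected_graph adj ->
  (complete_intersection K adj <->
   forall H : {set V}, complete_intersection K (induced_adj adj H)).
Proof.
move=> _ _; split=> [ciG H|/(_ setT)].
  by apply: complete_intersection_embedding ciG => //; apply: val_inj.
(* The graph embeds into its induced subgraph on all vertices. *)
by apply: (complete_intersection_embedding (phi := fun x => exist _ x (in_setT x))) => // x y [].
Qed.
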